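(* Let $K$ be an augmented directed complex. The functors $$\mathcal{C}_{\mathrm{da}}\to K\backslash\mathcal{C}_{\mathrm{da}},\quad L\mapsto(K\star L,\iota_1),\qquad\text{and}\qquad K\backslash\mathcal{C}_{\mathrm{da}}\to\mathcal{C}_{\mathrm{da}},\quad(M,g:K\to M)\mapsto g\backslash M,$$ form a pair of adjoint functors (the first being left adjoint to the second).
   Context: An augmented directed complex is a triple $(K,K^*,e)$ with $K$ a chain complex of abelian groups in degrees $\ge 0$, $e:K_0\to\mathbb{Z}$ a morphism with $ed_1=0$, and $K^*_n\subset K_n$ a submonoid for each $n\ge0$ (no compatibility with $d$ required). Morphisms are chain maps compatible with the augmentations and sending $K^*_n$ into $K'^*_n$; the category is $\mathcal{C}_{\mathrm{da}}$, and $K\backslash\mathcal{C}_{\mathrm{da}}$ is the category of objects under $K$. Join: $(K\star L)_p=\bigoplus_{i+1+j=p,\ i,j\ge-1}K_i\otimes L_j$ with $K_{-1}=L_{-1}=\mathbb{Z}$ (positive generator $\varnothing$, of degree $-1$; $K^*_{-1}=L^*_{-1}=\mathbb{N}$). Writing $x\star y$ for $x\otimes y$: $d(x\star y)=dx\star y+(-1)^{|x|+1}x\star dy$, with $dz=e(z)\varnothing$ for $|z|=0$ and $d\varnothing=0$; $e(x\star\varnothing)=e(x)$, $e(\varnothing\star y)=e(y)$; $(K\star L)^*_p$ is generated by the $x\star y$ with $x\in K_i^*$, $y\in L_j^*$, $i+1+j=p$. The morphism $\iota_1:K\to K\star L$ is $x\mapsto x\star\varnothing$. Slice: for a morphism $g:K\to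 M$, convene $K_{-1}=M_{-1}=\mathbb{Z}$, $K^*_{-1}=M^*_{-1}=\mathbb{N}$, $d_0=e$, $g_{-1}=\mathrm{id}_{\mathbb{Z}}$, and everything is $0$ in degrees $\le-2$. The augmented directed complex $g\backslash M$ is: $(g\backslash M)_i=\prod_{j\ge-1}\mathrm{Hom}(K_j,M_{i+j+1})$ for $i\ge1$; $(g\backslash M)_0\subset\prod_{j\ge-1}\mathrm{Hom}(K_j,M_{j+1})$ is the set of $(u_j)_{j\ge-1}$ with $(-1)^{j+1}(d_{j+1}u_j-u_{j-1}d_j)=e(u_{-1}(1))\,g_j$ for all $j\ge0$; $d_i(u)_j=(-1)^{j+1}(d_{i+j+1}u_j-u_{j-1}d_j)$ for $j\ge-1$ (with $u_{-2}=0$); $e(u)=e(u_{-1}(1))$; $(g\backslash M)^*_i$ consists of the $u\in(g\backslash M)_i$ with $u_j(K^*_j)\subset M^*_{i+j+1}$ for all $j\ge-1$. A morphism $f:(M,g)\to(M',g')$ under $K$ induces $g\backslash M\to g'\backslash M'$, $(u_j)_j\mapsto(fu_j)_j$. *)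

(* Defs.v *)
From HB Require Import structures.
From mathcomp Require Import all_boot all_order all_algebra.
From mathcomp Require Import boolp classical_sets.

Set Implicit Arguments.
Unset Strict Implicit.
Unset Printing Implicit Defensive.

Import Order.TTheory GRing.Theory Num.Theory.
Local Open Scope ring_scope.
Local Open Scope quotient_scope.

(** * Categories, functors, adjunctions *)

Record category := Category {
  obj :> Type;
  hom : obj -> obj -> Type;
  idm : forall X, hom X X;
  comp : forall X Y Z, hom Y Z -> hom X Y -> hom X Z;
  comp1m : forall X Y (f : hom X Y), comp (idm Y) f = f;
  compm1 : forall X Y (f : hom X Y), comp f (idm X) = f;
  compA : forall X Y Z T (h : hom Z T) (g : hom Y Z) (f : hom X Y),
    comp h (comp g f) = comp (comp h g) f }.
Arguments hom {c} X Y.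
Arguments idm {c} X.
Arguments comp {c X Y Z} g f.

Record functor (C D : category) := Functor {
  fobj :> C -> D;
  fmap : forall X Y : C, hom X Y -> hom (fobj X) (fobj Y);
  fmap_id : forall X : C, fmap (idm X) = idm (fobj X);
  fmap_comp : forall (X Y Z : C) (g : hom Y Z) (f : hom X Y),
    fmap (comp g f) = comp (fmap g) (fmap f) }.
Arguments fmap {C D} F {X Y} f : rename.

(* F is left adjoint to G *)
Definition adjoint (C D : category) (F : functor C D) (G : functor D C) : Prop :=
  exists phi : forall (X : C) (Y : D), hom (F X) Y -> hom X (G Y),
    (forall X Y, bijective (phi X Y)) /\
    (forall (X X' : C) (Y Y' : D) (a : hom X' X) (b : hom Y Y')
       (f : hom (F X) Y),
      phi X' Y' (comp b (comp f (fmap F a)))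
      = comp (fmap G b) (comp (phi X Y f) a)).

Section Under.
Variables (C : category) (A : C).

Record under_obj := UnderObj { under_cod : C; under_map : hom A under_cod }.

Record under_hom (X Y : under_obj) := UnderHom {
  under_fun : hom (under_cod X) (under_cod Y);
  under_comm : comp under_fun (under_map X) = under_map Y }.

Lemma under_hom_eq X Y (f g : under_hom X Y) :
  under_fun f = under_fun g -> f = g.
Proof.
by case: f g => [f pf] [g pg] /= e; case: _ / e pg => pg; congr UnderHom.
Qed.

Lemma under_id_subproof X : comp (idm (under_cod X)) (under_map X) = under_map X.
Proof. exact: comp1m. Qed.

Lemma under_comp_subproof X Y Z (g : under_hom Y Z) (f : under_hom X Y) :
  comp (comp (under_fun g) (under_fun f)) (under_map X) = under_map Z.
Proof. by rewrite -compA !under_comm. Qed.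

Definition under : category.
Proof.
refine (@Category under_obj under_hom
  (fun X => UnderHom (under_id_subproof X))
  (fun X Y Z g f => UnderHom (under_comp_subproof g f)) _ _ _).
- by move=> X Y f; apply: under_hom_eq; exact: comp1m.
- by move=> X Y f; apply: under_hom_eq; exact: compm1.
- by move=> X Y Z T h g f; apply: under_hom_eq; exact: compA.
Defined.

End Under.

(** * Abelian groups of morphisms, products *)

Lemma additive_eq (U V : zmodType) (f g : {additive U -> V}) : f =1 g -> f = g.
Proof.
case: f g => [f [[pf]]] [g [[pg]]] /= e.
have {}e : f = g by apply: funext.
by case: _ / e pg => pg; rewrite (Prop_irrelevance pf pg).
Qed.

Definition addid (U : zmodType) : {additive U -> U} := idfun.

Definition addcomp (U V W : zmodType) (g : {additive V -> W})
  (f : {additive U -> V}) : {additive U -> W} := g \o f.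

Lemma addcompE (U V W : zmodType) (g : {additive V -> W})
  (f : {additive U -> V}) x : addcomp g f x = g (f x).
Proof. by []. Qed.

Section HomZmod.
Variables U V : zmodType.
Local Notation homUV := {additive U -> V}.

HB.instance Definition _ := gen_eqMixin homUV.
HB.instance Definition _ := gen_choiceMixin homUV.

Definition hom_zero : homUV := \0.
Definition hom_opp (f : homUV) : homUV := \- f.
Definition hom_add (f g : homUV) : homUV := f \+ g.

Lemma hom_addA : associative hom_add.
Proof. by move=> f g h; apply: additive_eq => x /=; rewrite addrA. Qed.
Lemma hom_addC : commutative hom_add.
Proof. by move=> f g; apply: additive_eq => x /=; rewrite addrC. Qed.
Lemma hom_add0 : left_id hom_zero hom_add.
Proof. by move=> f; apply: additive_eq => x /=; rewrite add0r. Qed.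
Lemma hom_addN : left_inverse hom_zero hom_opp hom_add.
Proof. by move=> f; apply: additive_eq => x /=; rewrite addNr. Qed.

HB.instance Definition _ :=
  GRing.isZmodule.Build homUV hom_addA hom_addC hom_add0 hom_addN.
End HomZmod.

Lemma homD (U V : zmodType) (f g : {additive U -> V}) x : (f + g) x = f x + g x.
Proof. by []. Qed.

Lemma homN (U V : zmodType) (f : {additive U -> V}) x : (- f) x = - f x.
Proof. by []. Qed.

Lemma homMz (U V : zmodType) (f : {additive U -> V}) (m : int) x :
  (f *~ m) x = f x *~ m.
Proof.
have Mn k : (f *+ k) x = f x *+ k.
  by elim: k => [|k IH] //; rewrite !mulrS homD IH.
by case: m => k; rewrite ?NegzE ?mulrNz ?homN -!pmulrn Mn.
Qed.

Section DProd.
Variables (I : Type) (T : I -> zmodType).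

Definition dprod := forall i, T i.

HB.instance Definition _ := gen_eqMixin dprod.
HB.instance Definition _ := gen_choiceMixin dprod.

Definition dprod_zero : dprod := fun=> 0.
Definition dprod_opp (u : dprod) : dprod := fun i => - u i.
Definition dprod_add (u v : dprod) : dprod := fun i => u i + v i.

Lemma dprod_addA : associative dprod_add.
Proof. by move=> u v w; apply: functional_extensionality_dep => i; exact: addrA. Qed.
Lemma dprod_addC : commutative dprod_add.
Proof. by move=> u v; apply: functional_extensionality_dep => i; exact: addrC. Qed.
Lemma dprod_add0 : left_id dprod_zero dprod_add.
Proof. by move=> u; apply: functional_extensionality_dep => i; exact: add0r. Qed.
Lemma dprod_addN : left_inverse dprod_zero dprod_opp dprod_add.
Proof. by move=> u; apply: functional_extensionality_dep => i; exact: addNr. Qed.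

HB.instance Definition _ :=
  GRing.isZmodule.Build dprod dprod_addA dprod_addC dprod_add0 dprod_addN.
End DProd.

Lemma dprod_eq (I : Type) (T : I -> zmodType) (u v : dprod T) :
  (forall i, u i = v i) -> u = v.
Proof. exact: functional_extensionality_dep. Qed.

Lemma dprodD (I : Type) (T : I -> zmodType) (u v : dprod T) i :
  (u + v) i = u i + v i.
Proof. by []. Qed.

Lemma dprodN (I : Type) (T : I -> zmodType) (u : dprod T) i : (- u) i = - u i.
Proof. by []. Qed.

Lemma dprodMz (I : Type) (T : I -> zmodType) (u : dprod T) (m : int) i :
  (u *~ m) i = u i *~ m.
Proof.
have Mn k : (u *+ k) i = u i *+ k.
  by elim: k => [|k IH] //; rewrite !mulrS dprodD IH.
by case: m => k; rewrite ?NegzE ?mulrNz ?dprodN -!pmulrn Mn.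
Qed.

(** * Tensor product of abelian groups *)

Definition biadditive (A B C : zmodType) (f : A -> B -> C) : Prop :=
  (forall b, zmod_morphism (f^~ b)) /\ (forall a, zmod_morphism (f a)).

Section Tensor.
Variables A B : zmodType.

(* A word [:: (a_1, b_1); ...; (a_n, b_n)] stands for the sum of the a_k (x) b_k;
   the quotient of the monoid of words is automatically a group, the opposite of
   a (x) b being (- a) (x) b. *)
Inductive tens_rel : seq (A * B) -> seq (A * B) -> Prop :=
| tens_refl s : tens_rel s s
| tens_sym s t : tens_rel s t -> tens_rel t s
| tens_trans s t u : tens_rel s t -> tens_rel t u -> tens_rel s u
| tens_cat s s' t t' :
    tens_rel s s' -> tens_rel t t' -> tens_rel (s ++ t) (s' ++ t')
| tens_comm s t : tens_rel (s ++ t) (t ++ s)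
| tens_0l b : tens_rel [:: (0, b)] [::]
| tens_0r a : tens_rel [:: (a, 0)] [::]
| tens_Dl a a' b : tens_rel [:: (a + a', b)] [:: (a, b); (a', b)]
| tens_Dr a b b' : tens_rel [:: (a, b + b')] [:: (a, b); (a, b')].

Definition tens_relb (s t : seq (A * B)) : bool := `[< tens_rel s t >].

Lemma tens_relb_refl : reflexive tens_relb.
Proof. by move=> s; apply/asboolP; exact: tens_refl. Qed.
Lemma tens_relb_sym : symmetric tens_relb.
Proof. by move=> s t; apply/asboolP/asboolP; exact: tens_sym. Qed.
Lemma tens_relb_trans : transitive tens_relb.
Proof.
by move=> t s u /asboolP st /asboolP tu; apply/asboolP; exact: tens_trans tu.
Qed.

Canonical tens_equiv :=
  EquivRel tens_relb tens_relb_refl tens_relb_sym tens_relb_trans.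

Definition tens := {eq_quot tens_equiv}.
HB.instance Definition _ := Choice.on tens.
HB.instance Definition _ := EqQuotient.on tens.

Definition tpi (s : seq (A * B)) : tens := \pi_tens s.

Lemma tpiP s t : tpi s = tpi t <-> tens_rel s t.
Proof.
by split=> [/eqmodP/asboolP|st]; [|apply/eqmodP/asboolP].
Qed.

Lemma tpi_repr x : tpi (repr x) = x.
Proof. exact: reprK. Qed.

Lemma repr_tpi s : tens_rel (repr (tpi s)) s.
Proof. by apply/tpiP; rewrite tpi_repr. Qed.

Definition tens_zero : tens := tpi [::].
Definition tens_add (x y : tens) : tens := tpi (repr x ++ repr y).
Definition tens_opp (x : tens) : tens :=
  tpi [seq (- ab.1, ab.2) | ab <- repr x].

Lemma tens_addE s t : tens_add (tpi s) (tpi t) = tpi (s ++ t).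
Proof. by apply/tpiP/tens_cat; exact: repr_tpi. Qed.

Lemma tens_addA : associative tens_add.
Proof.
move=> x y z; rewrite -(tpi_repr x) -(tpi_repr y) -(tpi_repr z).
by rewrite !tens_addE catA.
Qed.
Lemma tens_addC : commutative tens_add.
Proof. by move=> x y; apply/tpiP; exact: tens_comm. Qed.
Lemma tens_add0 : left_id tens_zero tens_add.
Proof. by move=> x; rewrite -(tpi_repr x) tens_addE. Qed.
Lemma tens_addN : left_inverse tens_zero tens_opp tens_add.
Proof.
move=> x; rewrite -{2}(tpi_repr x) tens_addE; apply/tpiP.
elim: (repr x) => [|[a b] s IH] /=; first exact: tens_refl.
set s' := map _ s in IH *.
apply: (@tens_trans _ ([:: (- a, b)] ++ ([:: (a, b)] ++ (s' ++ s)))).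
  apply: (@tens_cat [:: (- a, b)] _ (s' ++ (a, b) :: s)); first exact: tens_refl.
  rewrite -[(a, b) :: s]cat1s !catA; apply: tens_cat; last exact: tens_refl.
  exact: tens_comm.
apply: (@tens_cat [:: (- a, b); (a, b)] [::] _ [::]) IH.
apply: tens_trans (tens_sym (tens_Dl (- a) a b)) _.
by rewrite addNr; exact: tens_0l.
Qed.

HB.instance Definition _ :=
  GRing.isZmodule.Build tens tens_addA tens_addC tens_add0 tens_addN.

Definition tmul (a : A) (b : B) : tens := tpi [:: (a, b)].

Lemma tpiD s t : tpi (s ++ t) = tpi s + tpi t.
Proof. by rewrite -tens_addE. Qed.

Lemma tmul_biadditive : biadditive tmul.
Proof.
have Dl b : {morph (tmul^~ b) : x y / x + y}.
  by move=> x y; rewrite /= /tmul -tpiD; apply/tpiP; exact: tens_Dl.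
have Dr a : {morph tmul a : x y / x + y}.
  by move=> x y; rewrite /= /tmul -tpiD; apply/tpiP; exact: tens_Dr.
split=> [b x y|a x y] /=; apply/eqP; rewrite eq_sym subr_eq.
  by rewrite -Dl subrK.
by rewrite -Dr subrK.
Qed.

Lemma tpiE s : tpi s = \sum_(ab <- s) tmul ab.1 ab.2.
Proof.
elim: s => [|[a b] s IH]; first by rewrite big_nil.
by rewrite -cat1s tpiD IH big_cons.
Qed.

Section Lift.
Variables (C : zmodType) (f : A -> B -> C).

Definition tens_lift_fun (x : tens) : C := \sum_(ab <- repr x) f ab.1 ab.2.

Hypothesis fP : biadditive f.

Lemma tens_lift_tpi s : tens_lift_fun (tpi s) = \sum_(ab <- s) f ab.1 ab.2.
Proof.
have Dl b x y : f (x + y) b = f x b + f y b.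
  by rewrite -[x in RHS](addrK y) (fP.1 b) subrK.
have Dr a x y : f a (x + y) = f a x + f a y.
  by rewrite -[x in RHS](addrK y) (fP.2 a) subrK.
have f0l b : f 0 b = 0 by rewrite -[0](subrr 0) (fP.1 b) subrr.
have f0r a : f a 0 = 0 by rewrite -[0](subrr 0) (fP.2 a) subrr.
rewrite /tens_lift_fun.
move: (repr_tpi s); move: (repr (tpi s)) => t; elim=> {t s} //.
- by move=> s t u _ -> _ ->.
- by move=> s s' t t' _ e _ e'; rewrite !big_cat /= e e'.
- by move=> s t; rewrite !big_cat /= addrC.
- by move=> b; rewrite big_seq1 big_nil.
- by move=> a; rewrite big_seq1 big_nil.
- by move=> a a' b; rewrite !big_cons !big_nil !addr0 Dl.
- by move=> a b b'; rewrite !big_cons !big_nil !addr0 Dr.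
Qed.

Lemma tens_lift_additive : zmod_morphism tens_lift_fun.
Proof.
have D : {morph tens_lift_fun : x y / x + y}.
  move=> x y; rewrite -(tpi_repr x) -(tpi_repr y) -tpiD.
  by rewrite !tens_lift_tpi big_cat.
by move=> x y; apply/eqP; rewrite eq_sym subr_eq -D subrK.
Qed.

Definition tens_lift : {additive tens -> C} :=
  HB.pack tens_lift_fun (GRing.isZmodMorphism.Build tens C _ tens_lift_additive).

Lemma tens_liftE a b : tens_lift (tmul a b) = f a b.
Proof. by rewrite /= tens_lift_tpi big_seq1. Qed.

End Lift.

Lemma tens_hom_eq (C : zmodType) (g h : {additive tens -> C}) :
  (forall a b, g (tmul a b) = h (tmul a b)) -> g = h.
Proof.
move=> e; apply: additive_eq => x; rewrite -(tpi_repr x) tpiE !raddf_sum.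
by apply: eq_bigr => ab _; exact: e.
Qed.

End Tensor.
Arguments tens_lift : simpl never.

Lemma tens_map_biadditive (A A' B B' : zmodType) (f : {additive A -> A'})
  (g : {additive B -> B'}) : biadditive (fun a b => tmul (f a) (g b)).
Proof.
have [tl tr] := tmul_biadditive A' B'.
by split=> [b x y|a x y] /=; rewrite raddfB ?tl ?tr.
Qed.

Definition tens_map (A A' B B' : zmodType) (f : {additive A -> A'})
    (g : {additive B -> B'}) : {additive tens A B -> tens A' B'} :=
  tens_lift (tens_map_biadditive f g).

Arguments tens_map : simpl never.

Lemma tens_mapE (A A' B B' : zmodType) (f : {additive A -> A'})
  (g : {additive B -> B'}) a b : tens_map f g (tmul a b) = tmul (f a) (g b).
Proof. exact: tens_liftE. Qed.

Lemma tens_map_comp (A A' A'' B B' B'' : zmodType)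
  (f : {additive A -> A'}) (f' : {additive A' -> A''})
  (g : {additive B -> B'}) (g' : {additive B' -> B''}) x :
  tens_map f' g' (tens_map f g x) = tens_map (addcomp f' f) (addcomp g' g) x.
Proof.
have -> : tens_map (addcomp f' f) (addcomp g' g)
  = addcomp (tens_map f' g') (tens_map f g) by
  apply: tens_hom_eq => a b; rewrite addcompE !tens_mapE.
by [].
Qed.

Lemma tens_map_id (A B : zmodType) (f : {additive A -> A})
  (g : {additive B -> B}) : f =1 id -> g =1 id -> tens_map f g =1 id.
Proof.
move=> fE gE x.
have -> // : tens_map f g = addid _.
by apply: tens_hom_eq => a b; rewrite tens_mapE fE gE.
Qed.

Lemma tens_map0l (A A' B B' : zmodType) (f : {additive A -> A'})
  (g : {additive B -> B'}) x : (forall a, f a = 0) -> tens_map f g x = 0.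
Proof.
move=> f0; have -> // : tens_map f g = 0.
apply: tens_hom_eq => a b; rewrite tens_mapE f0.
by rewrite -[0](subrr 0) (tmul_biadditive A' B').1 subrr.
Qed.

Lemma tens_map0r (A A' B B' : zmodType) (f : {additive A -> A'})
  (g : {additive B -> B'}) x : (forall b, g b = 0) -> tens_map f g x = 0.
Proof.
move=> g0; have -> // : tens_map f g = 0.
apply: tens_hom_eq => a b; rewrite tens_mapE g0.
by rewrite -[0](subrr 0) (tmul_biadditive A' B').2 subrr.
Qed.

Lemma mulz_biadditive : biadditive (fun m n : int => m * n).
Proof. by split=> [b x y|a x y] /=; rewrite ?mulrBl ?mulrBr. Qed.

Definition tens_int : {additive tens int int -> int} := tens_lift mulz_biadditive.

(** * Augmented directed complexes *)

Definition submonoid (V : zmodType) (S : set V) : Prop :=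
  S 0 /\ forall x y, S x -> S y -> S (x + y).

Lemma smallest_submonoid (V : zmodType) (G : set V) :
  submonoid (smallest (@submonoid V) G).
Proof.
split=> [A [[A0 _] _] //|x y xG yG A AG].
by have [[_ AD] _] := AG; apply: AD; [exact: xG|exact: yG].
Qed.

Lemma submonoid_preim (U V : zmodType) (f : {additive U -> V}) (S : set V) :
  submonoid S -> submonoid [set x | S (f x)].
Proof.
by move=> [S0 SD]; split=> [|x y] /=; rewrite ?raddf0 // raddfD; exact: SD.
Qed.

(* [bd n] is d_{n+1} *)
Record adc := Adc {
  carrier :> nat -> zmodType;
  bd : forall n, {additive carrier n.+1 -> carrier n};
  aug : {additive carrier 0 -> int};
  pos : forall n, set (carrier n);
  bd_bd : forall n (x : carrier n.+2), bd n (bd n.+1 x) = 0;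
  aug_bd : forall x : carrier 1, aug (bd 0 x) = 0;
  pos_submonoid : forall n, submonoid (@pos n) }.
Arguments bd : clear implicits.
Arguments aug : clear implicits.
Arguments pos : clear implicits.

Record adc_hom (K L : adc) := AdcHom {
  hom_map :> forall n, {additive K n -> L n};
  hom_bd : forall n (x : K n.+1), hom_map n (bd K n x) = bd L n (hom_map n.+1 x);
  hom_aug : forall x : K 0, aug L (hom_map 0 x) = aug K x;
  hom_pos : forall n (x : K n), pos K n x -> pos L n (hom_map n x) }.

Lemma adc_hom_eq (K L : adc) (f g : adc_hom K L) :
  (forall n, f n =1 g n) -> f = g.
Proof.
case: f g => [f f1 f2 f3] [g g1 g2 g3] /= e.
have {}e : f = g.
  by apply: functional_extensionality_dep => n; apply: additive_eq; exact: e.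
by case: _ / e g1 g2 g3 => g1 g2 g3; congr AdcHom; exact: Prop_irrelevance.
Qed.

Definition adc_id (K : adc) : adc_hom K K.
Proof. by refine (@AdcHom K K (fun n => addid (K n)) _ _ _). Defined.

Definition adc_comp (K L M : adc) (g : adc_hom L M) (f : adc_hom K L) :
  adc_hom K M.
Proof.
refine (@AdcHom K M (fun n => addcomp (g n) (f n)) _ _ _) => /=.
- by move=> n x; rewrite !hom_bd.
- by move=> x; rewrite !hom_aug.
- by move=> n x px; do 2!apply: hom_pos.
Defined.

Definition Cda : category.
Proof.
refine (@Category adc adc_hom adc_id adc_comp _ _ _).
- by move=> K L f; apply: adc_hom_eq.
- by move=> K L f; apply: adc_hom_eq.
- by move=> K L M N h g f; apply: adc_hom_eq.
Defined.

(* The extension of K by Z in degree -1, with all degrees shifted by one: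
   ext K n is K_{n-1}, ebd K n is d_n (so d_0 = e), epos K n is K*_{n-1},
   emor f n is f_{n-1}. *)
Definition ext (K : adc) (n : nat) : zmodType := if n is m.+1 then K m else int.

Definition ebd (K : adc) (n : nat) : {additive ext K n.+1 -> ext K n} :=
  if n is m.+1 return {additive ext K n.+1 -> ext K n} then bd K m else aug K.

Definition epos (K : adc) (n : nat) : set (ext K n) :=
  if n is m.+1 return set (ext K n) then pos K m else [set z : int | 0 <= z].

Definition emor (K L : adc) (f : adc_hom K L) (n : nat) :
    {additive ext K n -> ext L n} :=
  if n is m.+1 return {additive ext K n -> ext L n} then f m
  else addid int.

Lemma ebd_ebd (K : adc) n x : ebd K n (ebd K n.+1 x) = 0.
Proof. by case: n x => [|n] x; [exact: aug_bd|exact: bd_bd]. Qed.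

Lemma epos_submonoid (K : adc) n : submonoid (@epos K n).
Proof.
case: n => [|n]; last exact: pos_submonoid.
by split=> //= x y; exact: addr_ge0.
Qed.

Lemma emor_ebd (K L : adc) (f : adc_hom K L) n x :
  emor f n (ebd K n x) = ebd L n (emor f n.+1 x).
Proof. by case: n x => [|n] x /=; [rewrite hom_aug|exact: hom_bd]. Qed.

Lemma emor_epos (K L : adc) (f : adc_hom K L) n x :
  epos x -> epos (emor f n x).
Proof. by case: n x => [|n] x //; exact: hom_pos. Qed.

Lemma emor_id (K : adc) n : emor (adc_id K) n = addid _.
Proof. by case: n. Qed.

Lemma emor_comp (K L M : adc) (g : adc_hom L M) (f : adc_hom K L) n :
  emor (adc_comp g f) n = addcomp (emor g n) (emor f n).
Proof. by case: n => [|n] //; apply: additive_eq. Qed.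

(** * Joins *)

(* Bidegrees shifted as in [ext]: i + j = n stands for
   (i - 1) + 1 + (j - 1) = n - 1. *)
Definition bideg (n : nat) := {ij : nat * nat | (ij.1 + ij.2 == n)%N}.

Definition bidegL n (s : bideg n) : bideg n.+1 :=
  exist _ ((sval s).1.+1, (sval s).2) (svalP s).

Lemma bidegR_subproof n (s : bideg n) : ((sval s).1 + (sval s).2.+1 == n.+1)%N.
Proof. by rewrite addnS; exact: (svalP s). Qed.

Definition bidegR n (s : bideg n) : bideg n.+1 :=
  exist _ ((sval s).1, (sval s).2.+1) (bidegR_subproof s).

Lemma bidegLR n (s : bideg n) (T : nat -> nat -> Type)
  (u : forall t : bideg n.+2, T (sval t).1 (sval t).2) :
  u (bidegL (bidegR s)) = u (bidegR (bidegL s)).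
Proof.
suff E p (h h' : (p.1 + p.2 == n.+2)%N) : u (exist _ p h) = u (exist _ p h').
  exact: E.
by rewrite (bool_irrelevance h h').
Qed.

Lemma bidegl0_subproof n : ((n, 0).1 + (n, 0).2 == n)%N.
Proof. by rewrite /= addn0. Qed.

Definition bidegl0 n : bideg n := exist _ (n, 0)%N (bidegl0_subproof n).

Section Join.
Variables K L : adc.

(* The index set being finite, the product is the direct sum. *)
Definition jcarrier (n : nat) : zmodType :=
  dprod (fun s : bideg n => tens (ext K (sval s).1) (ext L (sval s).2)).

Definition jin n (s : bideg n) (z : tens (ext K (sval s).1) (ext L (sval s).2)) :
    jcarrier n :=
  dfwith (T := fun s : bideg n => tens (ext K (sval s).1) (ext L (sval s).2))
    (fun=> 0) z.

(* x \star y, for x and y of shifted degrees (sval s).1 and (sval s).2 *)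
Definition star n (s : bideg n) (x : ext K (sval s).1) (y : ext L (sval s).2) :
  jcarrier n := jin (tmul x y).

Definition jbd_fun n (u : jcarrier n.+1) : jcarrier n := fun s =>
  tens_map (ebd K (sval s).1) (addid (ext L (sval s).2))
    (u (bidegL s))
  + tens_map (addid (ext K (sval s).1)) (ebd L (sval s).2)
      (u (bidegR s)) *~ (-1) ^+ (sval s).1.

Lemma jin_in n (s : bideg n) z : @jin n s z s = z.
Proof. exact: dfwith_in. Qed.

Lemma jin_out n (s t : bideg n) z : s != t -> @jin n s z t = 0.
Proof. exact: dfwith_out. Qed.

Lemma star_irr n p (h h' : (p.1 + p.2 == n)%N) x y :
  @star n (exist _ p h) x y = @star n (exist _ p h') x y.
Proof. by rewrite (bool_irrelevance h h'). Qed.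

Lemma jbd_additive n : zmod_morphism (@jbd_fun n).
Proof.
move=> u v; apply: dprod_eq => s; rewrite /jbd_fun !(dprodD, dprodN).
by rewrite !raddfB mulrzBl addrACA -opprD.
Qed.

Definition jbd n : {additive jcarrier n.+1 -> jcarrier n} :=
  HB.pack (@jbd_fun n) (GRing.isZmodMorphism.Build _ _ _ (@jbd_additive n)).

Lemma jbd_jbd n (u : jcarrier n.+2) : jbd n (jbd n.+1 u) = 0.
Proof.
apply: dprod_eq => s; rewrite /= /jbd_fun !raddfD !raddfMz !tens_map_comp.
rewrite tens_map0l; last exact: ebd_ebd.
rewrite (@tens_map0r _ _ _ _ _ (addcomp (ebd L _) (ebd L _))); last exact: ebd_ebd.
have -> : (-1) ^+ (sval (bidegL s)).1 = - (-1) ^+ (sval s).1 :> int.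
  by rewrite exprS mulN1r.
rewrite mul0rz add0r addr0 mulrNz; apply/eqP.
rewrite addrC subr_eq0; apply/eqP; congr (_ *~ _).
rewrite (_ : u (bidegL (bidegR s)) = u (bidegR (bidegL s))).
  by congr (tens_map _ _ _); apply: additive_eq.
exact: (bidegLR s (T := fun i j => tens (ext K i) (ext L j))).
Qed.

Lemma bidegL_inj n : injective (@bidegL n).
Proof.
move=> s t /(congr1 sval) [e1 e2]; apply: val_inj.
by rewrite [LHS]surjective_pairing e1 e2 -surjective_pairing.
Qed.

Lemma bidegR_inj n : injective (@bidegR n).
Proof.
move=> s t /(congr1 sval) [e1 e2]; apply: val_inj.
by rewrite [LHS]surjective_pairing e1 e2 -surjective_pairing.
Qed.

(* d(x \star y) = dx \star y + (-1)^{|x|+1} x \star dy *)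
Lemma jbd_star n (s : bideg n) (x : ext K (sval s).1.+1)
    (y : ext L (sval s).2.+1) :
  jbd n.+1 (star (s := bidegL (bidegR s)) x y)
  = star (s := bidegR s) (ebd K (sval s).1 x) y
    + star (s := bidegL s) x (ebd L (sval s).2 y) *~ (-1) ^+ (sval s).1.+1.
Proof.
apply: dprod_eq => t; rewrite dprodD -[jbd _ _ t]/(jbd_fun _ t) /jbd_fun.
congr (_ + _).
  rewrite /star; have [<-|st] := eqVneq (bidegR s) t.
    by rewrite !jin_in tens_mapE.
  by rewrite !jin_out ?raddf0 // (inj_eq (@bidegL_inj _)).
rewrite dprodMz.
have -> : star (s := bidegL (bidegR s)) x y = star (s := bidegR (bidegL s)) x y.
  exact: star_irr.
rewrite /star; have [<-|st] := eqVneq (bidegL s) t.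
  by rewrite !jin_in tens_mapE.
by rewrite !jin_out ?raddf0 ?mul0rz // (inj_eq (@bidegR_inj _)).
Qed.

(* d(x \star \varnothing) = dx \star \varnothing *)
Lemma jbd_star_l n (s : bideg n) (x : ext K (sval s).1.+1) (y : ext L (sval s).2) :
  (sval s).2 = 0%N ->
  jbd n (star (s := bidegL s) x y) = star (ebd K (sval s).1 x) y.
Proof.
move=> s2; apply: dprod_eq => t.
rewrite -[jbd n _ t]/(jbd_fun _ t) /jbd_fun /star (@jin_out _ _ (bidegR t)).
  rewrite raddf0 mul0rz addr0; have [<-|st] := eqVneq s t.
    by rewrite !jin_in tens_mapE.
  by rewrite !jin_out ?raddf0 // (inj_eq (@bidegL_inj n)).
by apply/eqP => /(congr1 sval) /= [_]; rewrite s2.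
Qed.

(* d(\varnothing \star y) = \varnothing \star dy *)
Lemma jbd_star_r n (s : bideg n) (x : ext K (sval s).1) (y : ext L (sval s).2.+1) :
  (sval s).1 = 0%N ->
  jbd n (star (s := bidegR s) x y) = star x (ebd L (sval s).2 y).
Proof.
move=> s1; apply: dprod_eq => t.
rewrite -[jbd n _ t]/(jbd_fun _ t) /jbd_fun /star (@jin_out _ _ (bidegL t)).
  rewrite raddf0 add0r; have [<-|st] := eqVneq s t.
    by rewrite !jin_in tens_mapE (_ : (-1) ^+ (sval s).1 = 1) // s1.
  by rewrite !jin_out ?raddf0 ?mul0rz // (inj_eq (@bidegR_inj n)).
by apply/eqP => /(congr1 sval) /= [+ _]; rewrite s1.
Qed.

Definition bideg00 : bideg 0 := exist _ (0, 0)%N isT.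
Definition bideg10 : bideg 1 := bidegL bideg00.
Definition bideg01 : bideg 1 := bidegR bideg00.

(* e(x \star \varnothing) = e(x) and e(\varnothing \star y) = e(y) *)
Definition jaug_fun (u : jcarrier 1) : int :=
  tens_int (tens_map (aug K) (addid int) (u bideg10))
  + tens_int (tens_map (addid int) (aug L) (u bideg01)).

Lemma jaug_additive : zmod_morphism jaug_fun.
Proof.
move=> u v; rewrite /jaug_fun !(dprodD, dprodN).
by rewrite !raddfB addrACA -opprD.
Qed.

Definition jaug : {additive jcarrier 1 -> int} :=
  HB.pack jaug_fun (GRing.isZmodMorphism.Build _ _ _ jaug_additive).

Lemma jaugE (u : jcarrier 1) : jaug u = tens_int (jbd 0 u bideg00).
Proof. by rewrite -[jbd 0 u _]/(jbd_fun u _) /jbd_fun raddfD expr0 mulr1z. Qed.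

Lemma jaug_jbd (u : jcarrier 2) : jaug (jbd 1 u) = 0.
Proof. by rewrite jaugE jbd_jbd raddf0. Qed.

Definition jpos (n : nat) : set (jcarrier n) :=
  smallest (@submonoid (jcarrier n))
    [set u | exists s x y, [/\ epos x, epos y & u = @star n s x y]].

Definition join : adc :=
  @Adc (fun n => jcarrier n.+1) (fun n => jbd n.+1) jaug
    (fun n => @jpos n.+1) (fun n => @jbd_jbd n.+1) jaug_jbd
    (fun n => @smallest_submonoid _ _).

(* x \mapsto x \star \varnothing *)
Definition iota_fun n (x : K n) : join n := star (s := bidegl0 n.+1) x (1 : int).

Lemma iota_additive n : zmod_morphism (@iota_fun n).
Proof.
move=> x y; apply: dprod_eq => t; rewrite dprodD dprodN /iota_fun /star.
have [<-|st] := eqVneq (bidegl0 n.+1) t; last by rewrite !jin_out ?subr0.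
by rewrite !jin_in (tmul_biadditive _ _).1.
Qed.

Definition iota_map n : {additive K n -> join n} :=
  HB.pack (@iota_fun n) (GRing.isZmodMorphism.Build _ _ _ (@iota_additive n)).

Definition iota1 : adc_hom K join.
Proof.
refine (@AdcHom K join iota_map _ _ _).
- move=> n x; rewrite -[LHS]/(iota_fun _) -[iota_map _ x]/(iota_fun x).
  rewrite -[RHS]/(jbd n.+1 _) /iota_fun.
  have -> : star (s := bidegl0 n.+2) x (1 : int)
      = star (s := bidegL (bidegl0 n.+1)) x (1 : int) by exact: star_irr.
  exact/esym/(@jbd_star_l _ (bidegl0 n.+1) x (1 : int)).
- move=> x; rewrite -[LHS]/(jaug_fun (iota_fun x)) /jaug_fun /iota_fun.
  have -> : star (s := bidegl0 1) x (1 : int) = star (s := bideg10) x (1 : int).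
    exact: star_irr.
  rewrite /star.
  rewrite (@jin_in _ bideg10) (@jin_out _ bideg10 bideg01) // raddf0 raddf0 addr0.
  by rewrite tens_mapE tens_liftE mulr1.
- by move=> n x px; apply: sub_gen_smallest; exists (bidegl0 n.+1), x, 1.
Defined.

End Join.

Section JoinMap.
Variables (K L L' : adc) (f : adc_hom L L').

(* K \star f *)
Definition jmap_fun n (u : jcarrier K L n) : jcarrier K L' n := fun s =>
  tens_map (addid (ext K (sval s).1)) (emor f (sval s).2) (u s).

Lemma jmap_additive n : zmod_morphism (@jmap_fun n).
Proof.
by move=> u v; apply: dprod_eq => s; rewrite /jmap_fun !(dprodD, dprodN) raddfB.
Qed.

Definition jmap n : {additive jcarrier K L n -> jcarrier K L' n} :=
  HB.pack (@jmap_fun n) (GRing.isZmodMorphism.Build _ _ _ (@jmap_additive n)).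

Lemma jmap_star n (s : bideg n) x y :
  jmap n (star (s := s) x y) = star x (emor f _ y).
Proof.
apply: dprod_eq => t; rewrite -[LHS]/(jmap_fun _ t) /jmap_fun /star.
have [<-|st] := eqVneq s t; first by rewrite !jin_in tens_mapE.
by rewrite !jin_out ?raddf0.
Qed.

Lemma jmap_jbd n u : jmap n (jbd K L n u) = jbd K L' n (jmap n.+1 u).
Proof.
apply: dprod_eq => s; rewrite -[LHS]/(jmap_fun (jbd_fun u) s).
rewrite -[RHS]/(jbd_fun (jmap_fun u) s) /jmap_fun /jbd_fun.
rewrite raddfD raddfMz !tens_map_comp; congr (tens_map _ _ _ + tens_map _ _ _ *~ _).
by apply: additive_eq => y; exact: emor_ebd.
Qed.

Definition join_mapr : adc_hom (join K L) (join K L').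
Proof.
refine (@AdcHom (join K L) (join K L') (fun n => jmap n.+1) _ _ _).
- by move=> n u; exact: jmap_jbd.
- move=> u; rewrite -[aug _ _]/(jaug _ _ _) -[aug _ u]/(jaug _ _ _) !jaugE.
  rewrite -jmap_jbd; congr (tens_int _).
  rewrite -[LHS]/(tens_map (addid int) (addid int) (jbd K L 0 u bideg00)).
  exact: tens_map_id.
- move=> n u; apply: (smallest_sub (X := [set v | jpos (jmap n.+1 v)])).
    exact/submonoid_preim/smallest_submonoid.
  move=> _ [s [x [y [px py ->]]]]; rewrite -[_ (star _ _)]/(jpos (jmap _ _)) jmap_star.
  by apply: sub_gen_smallest; exists s, x, (emor f _ y); split=> //; exact: emor_epos.
Defined.

End JoinMap.

Lemma join_mapr_iota1 (K L L' : adc) (f : adc_hom L L') :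
  adc_comp (join_mapr K f) (iota1 K L) = iota1 K L'.
Proof. by apply: adc_hom_eq => n x; exact: (@jmap_star K L L'). Qed.

Lemma join_mapr_id (K L : adc) : join_mapr K (adc_id L) = adc_id (join K L).
Proof.
apply: adc_hom_eq => n u; apply: dprod_eq => s.
by apply: tens_map_id => // y; rewrite emor_id.
Qed.

Lemma join_mapr_comp (K L L' L'' : adc) (g : adc_hom L' L'') (f : adc_hom L L') :
  join_mapr K (adc_comp g f) = adc_comp (join_mapr K g) (join_mapr K f).
Proof.
apply: adc_hom_eq => n u; apply: dprod_eq => s.
rewrite -[LHS]/(tens_map _ _ (u s)) -[RHS]/(tens_map _ _ (tens_map _ _ (u s))).
by rewrite tens_map_comp emor_comp; congr (tens_map _ _ _); exact: additive_eq.
Qed.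

(* L \mapsto (K \star L, \iota_1) *)
Definition join_functor (K : adc) : functor Cda (@under Cda K).
Proof.
refine (@Functor Cda (@under Cda K)
  (fun L => @UnderObj Cda K (join K L) (iota1 K L))
  (fun L L' f => @UnderHom Cda K (@UnderObj Cda K (join K L) (iota1 K L))
     (@UnderObj Cda K (join K L') (iota1 K L')) (join_mapr K f)
     (join_mapr_iota1 K f)) _ _).
- by move=> L; apply: under_hom_eq; exact: join_mapr_id.
- by move=> L L' L'' g f; apply: under_hom_eq; exact: join_mapr_comp.
Defined.

(** * Slices *)

(* Pairs (j, m) with i + j = m; the redundant component m avoids transport
   along i + j.+1 = (i + j).+1. *)
Definition hidx (i : nat) := {jm : nat * nat | (i + jm.1 == jm.2)%N}.

Lemma hidxR_subproof i (s : hidx i) : (i.+1 + (sval s).1 == (sval s).2.+1)%N.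
Proof. by rewrite addSn eqSS; exact: (svalP s). Qed.

Definition hidxR i (s : hidx i) : hidx i.+1 :=
  exist _ ((sval s).1, (sval s).2.+1) (hidxR_subproof s).

Lemma hidxL_subproof i j m : (i + j.+1 == m)%N -> (i.+1 + j == m)%N.
Proof. by rewrite addSnnS. Qed.

Definition hidxL i j m (h : (i + j.+1 == m)%N) : hidx i.+1 :=
  exist _ (j, m) (hidxL_subproof h).

Section Hom.
Variables K M : adc.

(* With shifted degrees, hcarrier i is the product over j >= -1 of the
   Hom(K_j, M_{(i - 1) + j + 1}). *)
Definition hcarrier (i : nat) : zmodType :=
  dprod (fun s : hidx i => {additive ext K (sval s).1 -> ext M (sval s).2}).

(* u_{j-1} d_j, with u_{-2} = 0 *)
Definition hprev i (u : hcarrier i.+1) (j m : nat) :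
    (i + j == m)%N -> {additive ext K j -> ext M m} :=
  if j is j'.+1 return (i + j == m)%N -> {additive ext K j -> ext M m}
  then fun h => addcomp (u (hidxL h)) (ebd K j') else fun=> 0.

Definition hbd_fun i (u : hcarrier i.+1) : hcarrier i := fun s =>
  (addcomp (ebd M (sval s).2) (u (hidxR s)) - hprev u (svalP s))
    *~ (-1) ^+ (sval s).1.

Lemma hprevB i (u v : hcarrier i.+1) j m (h : (i + j == m)%N) :
  hprev (u - v) h = hprev u h - hprev v h.
Proof. by case: j h => [|j] h /=; [rewrite subrr|exact: additive_eq]. Qed.

Lemma hprev_ebd i (u : hcarrier i.+1) j m (h : (i + j == m)%N) x :
  hprev u h (ebd K j x) = 0.
Proof. by case: j h x => [|j] h x //=; rewrite ebd_ebd raddf0. Qed.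

Lemma hbd_additive i : zmod_morphism (@hbd_fun i).
Proof.
move=> u v; apply: dprod_eq => s; rewrite dprodD dprodN /hbd_fun.
rewrite hprevB -mulrzBl; congr (_ *~ _); apply: additive_eq => x.
rewrite !(homD, homN, addcompE, dprodD, dprodN) raddfB !opprD !opprK.
by rewrite addrACA.
Qed.

Definition hbd i : {additive hcarrier i.+1 -> hcarrier i} :=
  HB.pack (@hbd_fun i) (GRing.isZmodMorphism.Build _ _ _ (@hbd_additive i)).

Lemma hbd_hbd i (u : hcarrier i.+2) : hbd i (hbd i.+1 u) = 0.
Proof.
apply: dprod_eq => -[[j m] h]; rewrite -[LHS]/(hbd_fun (hbd_fun u) _).
apply: additive_eq => x; rewrite /hbd_fun homMz homD homN !addcompE /=.
rewrite homMz homD homN raddfMz raddfB addcompE /= ebd_ebd sub0r.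
case: j h x => [|j] h x /=; first by rewrite !(raddf0, oppr0, mul0rz, subr0).
rewrite homMz homD homN !addcompE /= hprev_ebd subr0.
rewrite exprS mulN1r !mulrNz mulNrz opprK /hidxL /hidxR /=.
rewrite -mulrzBl [X in X *~ _ *~ _](_ : _ = 0) ?mul0rz ?oppr0 //.
apply/eqP; rewrite subr_eq0; apply/eqP; congr (ebd M m _).
have E (h1 h2 : (i.+2 + j == m.+1)%N) y :
    (u (exist _ (j, m.+1) h1) : {additive ext K j -> ext M m.+1}) y
    = (u (exist _ (j, m.+1) h2) : {additive ext K j -> ext M m.+1}) y.
  by rewrite (bool_irrelevance h1 h2).
exact: E.
Qed.

Definition hmono i (u : hcarrier i) : Prop :=
  forall (s : hidx i) x, epos x -> epos (u s x).

End Hom.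

Definition hidx0 j : hidx 0 := exist _ (j, j) (eqxx j).

(* the index of u_{-1} : K_{-1} -> M_0 *)
Definition hidx01 : hidx 1 := exist _ (0, 1)%N isT.

Section Slice.
Variables (K M : adc) (g : adc_hom K M).

(* e(u_{-1}(1)) *)
Definition haug_fun (u : hcarrier K M 1) : int := aug M (u hidx01 (1 : int)).

Lemma haug_additive : zmod_morphism haug_fun.
Proof. by move=> u v; rewrite /haug_fun dprodD dprodN homD homN raddfB. Qed.

Definition haug : {additive hcarrier K M 1 -> int} :=
  HB.pack haug_fun (GRing.isZmodMorphism.Build _ _ _ haug_additive).

(* [hidx0 j.+1] and [emor g j.+1] are the components of (unshifted) degree j *)
Definition slice0_pred : {pred hcarrier K M 1} := fun u =>
  `[< forall j : nat, hbd K M 0 u (hidx0 j.+1) = emor g j.+1 *~ haug u >].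

Lemma slice0_closed : zmod_closed slice0_pred.
Proof.
split=> [|u v /asboolP uP /asboolP vP]; apply/asboolP => j.
  by rewrite !raddf0.
by rewrite !raddfB dprodD dprodN uP vP.
Qed.

HB.instance Definition _ := GRing.isZmodClosed.Build _ slice0_pred slice0_closed.

Record slice0 := Slice0 {
  slice0_val :> hcarrier K M 1;
  slice0P : slice0_val \in slice0_pred }.

HB.instance Definition _ := [isSub for slice0_val].
HB.instance Definition _ := [Choice of slice0 by <:].
HB.instance Definition _ := [SubChoice_isSubZmodule of slice0 by <:].

Definition slice_carrier (i : nat) : zmodType :=
  if i is 0 then slice0 else hcarrier K M i.+1.

Lemma haug_hbd (u : hcarrier K M 2) : haug (hbd K M 1 u) = 0.
Proof.
rewrite -[LHS]/(aug M (hbd_fun u hidx01 (1 : int))) /hbd_fun homMz expr0 mulr1z.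
by rewrite homD homN subr0 addcompE aug_bd.
Qed.

Lemma slice_bd0_subproof (u : hcarrier K M 2) : hbd K M 1 u \in slice0_pred.
Proof.
by apply/asboolP => j; rewrite hbd_hbd haug_hbd mulr0z.
Qed.

Definition slice_bd0_fun (u : hcarrier K M 2) : slice0 :=
  Slice0 (slice_bd0_subproof u).

Lemma slice_bd0_additive : zmod_morphism slice_bd0_fun.
Proof.
by move=> u v; apply: val_inj; rewrite [RHS]raddfB; exact: (raddfB (hbd K M 1)).
Qed.

Definition slice_bd0 : {additive hcarrier K M 2 -> slice0} :=
  HB.pack slice_bd0_fun (GRing.isZmodMorphism.Build _ _ _ slice_bd0_additive).

Definition slice_bd (i : nat) :
    {additive slice_carrier i.+1 -> slice_carrier i} :=
  if i is i'.+1 return {additive slice_carrier i.+1 -> slice_carrier i}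
  then hbd K M i'.+2 else slice_bd0.

Definition slice_aug : {additive slice_carrier 0 -> int} :=
  addcomp haug (val : {additive slice0 -> hcarrier K M 1}).

Definition slice_pos (i : nat) : set (slice_carrier i) :=
  if i is i'.+1 return set (slice_carrier i)
  then [set u : hcarrier K M i'.+2 | hmono u]
  else [set u : slice0 | hmono (val u)].

Lemma hmono_submonoid i : submonoid [set u : hcarrier K M i | hmono u].
Proof.
split=> [s x _|u v pu pv s x px] /=; first exact: (epos_submonoid M _).1.
by apply: (epos_submonoid M _).2; [exact: pu|exact: pv].
Qed.

Lemma slice_bd_bd i (u : slice_carrier i.+2) : slice_bd i (slice_bd i.+1 u) = 0.
Proof.
case: i u => [|i] u; last exact: hbd_hbd.
by apply: val_inj; exact: hbd_hbd.
Qed.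

Lemma slice_aug_bd (u : slice_carrier 1) : slice_aug (slice_bd 0 u) = 0.
Proof. exact: haug_hbd. Qed.

Lemma slice_pos_submonoid i : submonoid (@slice_pos i).
Proof.
case: i => [|i]; last exact: hmono_submonoid.
exact: (@submonoid_preim slice0 _ val _ (hmono_submonoid 1)).
Qed.

Definition slice : adc :=
  Adc slice_bd_bd slice_aug_bd slice_pos_submonoid.

End Slice.

Section SliceMap.
Variables (K M M' : adc) (g : adc_hom K M) (g' : adc_hom K M')
  (f : adc_hom M M').

(* (u_j)_j \mapsto (f u_j)_j *)
Definition hmap_fun i (u : hcarrier K M i) : hcarrier K M' i := fun s =>
  addcomp (emor f (sval s).2) (u s).

Lemma hmap_additive i : zmod_morphism (@hmap_fun i).
Proof.
move=> u v; apply: dprod_eq => s; apply: additive_eq => x.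
by rewrite /hmap_fun !(dprodD, dprodN, homD, homN, addcompE) raddfB.
Qed.

Definition hmap i : {additive hcarrier K M i -> hcarrier K M' i} :=
  HB.pack (@hmap_fun i) (GRing.isZmodMorphism.Build _ _ _ (@hmap_additive i)).

Lemma hmap_hbd i u : hmap i (hbd K M i u) = hbd K M' i (hmap i.+1 u).
Proof.
apply: dprod_eq => -[[j m] h]; apply: additive_eq => x.
rewrite -[hmap _ _ _]/(addcomp (emor f _) (hbd_fun u _)).
rewrite -[hbd _ _ _ _ _]/(hbd_fun (hmap_fun u) _) /hbd_fun.
rewrite addcompE !homMz !(homD, homN) raddfMz raddfB; congr ((_ - _) *~ _).
  by rewrite !addcompE emor_ebd.
by case: j h x => [|j] h x //=; rewrite raddf0.
Qed.

Hypothesis fg : adc_comp f g = g'.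

Lemma hmap_slice0 (u : hcarrier K M 1) :
  u \in slice0_pred g -> hmap 1 u \in slice0_pred g'.
Proof.
move=> /asboolP uP; apply/asboolP => j.
rewrite -hmap_hbd -[LHS]/(addcomp (emor f j.+1) (hbd K M 0 u (hidx0 j.+1))) uP.
rewrite -[haug _ _ (hmap 1 u)]/(aug M' (f 0%N (u hidx01 (1 : int)))) hom_aug.
apply: additive_eq => x; rewrite addcompE !homMz raddfMz -fg; congr (_ *~ _).
Qed.

Definition slice_map0_fun (u : slice0 g) : slice0 g' :=
  Slice0 (hmap_slice0 (slice0P u)).

Lemma slice_map0_additive : zmod_morphism slice_map0_fun.
Proof.
by move=> u v; apply: val_inj; rewrite [RHS]raddfB; exact: (raddfB (hmap 1)).
Qed.

Definition slice_map0 : {additive slice0 g -> slice0 g'} :=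
  HB.pack slice_map0_fun (GRing.isZmodMorphism.Build _ _ _ slice_map0_additive).

Definition slice_map_fun (i : nat) : {additive slice g i -> slice g' i} :=
  if i is i'.+1 return {additive slice g i -> slice g' i}
  then hmap i'.+2 else slice_map0.

Lemma hmap_hmono i (u : hcarrier K M i) : hmono u -> hmono (hmap i u).
Proof. by move=> pu s x px; apply: emor_epos; exact: pu. Qed.

Definition slice_map : adc_hom (slice g) (slice g').
Proof.
refine (@AdcHom (slice g) (slice g') slice_map_fun _ _ _).
- case=> [|i] u; last exact: hmap_hbd.
  by apply: val_inj; exact: hmap_hbd.
- by move=> u; exact: hom_aug.
- by case=> [|i] u; exact: hmap_hmono.
Defined.

End SliceMap.

(* (M, g) \mapsto g \backslash M *)
Definition slice_functor (K : adc) : functor (@under Cda K) Cda.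
Proof.
refine (@Functor (@under Cda K) Cda
  (fun X : @under Cda K => slice (under_map X))
  (fun X Y f => slice_map (under_comm f)) _ _).
- move=> X; apply: adc_hom_eq => -[|i] u; first apply: val_inj.
    by apply: dprod_eq => s; apply: additive_eq => x; rewrite /= /hmap_fun emor_id.
  by apply: dprod_eq => s; apply: additive_eq => x; rewrite /= /hmap_fun emor_id.
- move=> X Y Z g f; apply: adc_hom_eq => -[|i] u; first apply: val_inj.
    by apply: dprod_eq => s; apply: additive_eq => x; rewrite /= /hmap_fun emor_comp.
  by apply: dprod_eq => s; apply: additive_eq => x; rewrite /= /hmap_fun emor_comp.
Defined.

(* Main.v *)
From HB Require Import structures.
From mathcomp Require Import all_boot all_algebra.
From mathcomp Require Import boolp classical_sets.
Require Import Defs.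

Set Implicit Arguments.
Unset Strict Implicit.
Unset Printing Implicit Defensive.

Import GRing.Theory.
Local Open Scope ring_scope.

(** The adjunction is a currying.  A map f out of the join K * L is determined
    by its values f (x * y), which are additive in x and in y; fixing y gives
    the family u_j : x |-> f (x * y) on the K_j, that is, an element of the
    product of the Hom(K_j, M_{i+j+1}), and y |-> u is the transposed map from
    L to the slice.  No sign is inserted: solving the equation
    f d (x * y) = d f (x * y) for the term f (x * dy) in which L is
    differentiated gives exactly
    u^{dy}_j = (-1)^{j+1} (d u^y_j - u^y_{j-1} d), which is the differential
    of the slice.

    The degree -1 conventions make the boundary cases instances of this one
    formula.  Extend f by the multiplication of integers in degree -1, and
    extend a map h from L to the slice by m |-> m (g_j)_j on L_{-1} = Z.  For y
    of degree 0 the formula then reads d(u) = e(y) (g_j)_j: its component in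
    degree -1 is the compatibility of h with augmentations, and its
    components in degrees >= 0 are the condition that cuts the degree 0
    part of the slice out of the whole product.  For y = m in degree -1, the
    value f (x * m) = m g(x) records that f is a map under K.

    So both Hom-sets are described by families of additive maps, with no
    special low degrees: [join_family] (families on joins) and [slice_family]
    (families with values in products of Hom groups).  The bijection [curry]
    between bare families comes from the universal properties of the tensor
    product and of the direct sum.  [curry_bd] states that the failures of the
    two differential conditions agree up to sign, so that [curry] exchanges the
    two descriptions ([join_family_curry]).  Positive cones correspond since
    that of the join is generated by the x * y with x and y positive, and
    naturality is evident on such elements. *)

(** * Additive maps out of a join *)

Definition dproj (I : Type) (T : I -> zmodType) (i : I) :
    {additive dprod T -> T i} :=
  HB.pack (fun u : dprod T => u i)
    (GRing.isZmodMorphism.Build (dprod T) (T i) (fun u : dprod T => u i)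
      (fun _ _ => erefl)).

Lemma int_additive_eq (V : zmodType) (f g : {additive int -> V}) :
  f 1 = g 1 -> f =1 g.
Proof. by move=> fg1 n; rewrite -(intz n) !raddfMz fg1. Qed.

Lemma sign_mulrzK (V : zmodType) j : involutive (fun z : V => z *~ (-1) ^+ j).
Proof. by move=> z; rewrite -mulrzA -expr2 sqrr_sign mulr1z. Qed.

Lemma bideg0_eq (s : bideg 0) : s = bideg00.
Proof.
apply: val_inj; case: s => -[j i] /=.
by rewrite addn_eq0 => /andP[/eqP-> /eqP->].
Qed.

Section JoinSum.
Variables (K L : adc) (n : nat).

Lemma bsplit_subproof (k : 'I_n.+1) : (k + (n - k) == n)%N.
Proof. by rewrite subnKC // -ltnS. Qed.

(** The bidegrees of total degree n, as a type with n + 1 elements over which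
    one can sum. *)
Definition bsplit (k : 'I_n.+1) : bideg n :=
  exist _ (k : nat, n - k)%N (bsplit_subproof k).

Lemma bsplit_inj : injective bsplit.
Proof. by move=> k l /(congr1 sval) [/val_inj]. Qed.

Lemma bsplit_surj (s : bideg n) : exists k, s = bsplit k.
Proof.
case: s => -[j i] h; have jn : (j < n.+1)%N by rewrite ltnS -(eqP h) leq_addr.
by exists (Ordinal jn); apply: val_inj; rewrite /= -(eqP h) addKn.
Qed.

Local Notation tensKL s := (tens (ext K (sval s).1) (ext L (sval s).2)).

Lemma jin_additive (s : bideg n) : zmod_morphism (@jin K L n s).
Proof.
move=> y z; apply: dprod_eq => t; rewrite dprodD dprodN.
by have [<-|st] := eqVneq s t; rewrite ?jin_in // !jin_out ?subr0.
Qed.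

Definition jinj (s : bideg n) : {additive tensKL s -> jcarrier K L n} :=
  HB.pack (@jin K L n s) (GRing.isZmodMorphism.Build _ _ _ (@jin_additive s)).

(** The product over bidegrees is a direct sum, as there are finitely many of
    them. *)
Lemma jcarrier_sum (u : jcarrier K L n) :
  u = \sum_(k < n.+1) jinj (bsplit k) (u (bsplit k)).
Proof.
apply: dprod_eq => s; rewrite -[RHS]/(dproj _ s _) raddf_sum /=.
have [k ->] := bsplit_surj s.
rewrite (bigD1 k) //= jin_in big1 ?addr0 // => l lk.
by rewrite jin_out // (inj_eq bsplit_inj).
Qed.

Section Copair.
Variables (V : zmodType) (f : forall s : bideg n, {additive tensKL s -> V}).

Definition jcopair_fun (u : jcarrier K L n) : V :=
  \sum_(k < n.+1) f (bsplit k) (u (bsplit k)).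

Lemma jcopair_additive : zmod_morphism jcopair_fun.
Proof.
move=> u v; rewrite /jcopair_fun -sumrB; apply: eq_bigr => k _.
by rewrite dprodD dprodN raddfB.
Qed.

Definition jcopair : {additive jcarrier K L n -> V} :=
  HB.pack jcopair_fun (GRing.isZmodMorphism.Build _ _ _ jcopair_additive).

Lemma jcopair_jin (s : bideg n) z : jcopair (jin z) = f s z.
Proof.
have [k sk] := bsplit_surj s; rewrite /= /jcopair_fun.
move: z; rewrite sk => z.
rewrite (bigD1 k) //= jin_in big1 ?addr0 // => l lk.
by rewrite jin_out ?raddf0 // (inj_eq bsplit_inj) eq_sym.
Qed.

End Copair.

Lemma jcarrier_hom_eq (V : zmodType) (f g : {additive jcarrier K L n -> V}) :
  (forall s x y, f (@star K L n s x y) = g (star x y)) -> f =1 g.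
Proof.
move=> fg u; rewrite (jcarrier_sum u) !raddf_sum; apply: eq_bigr => k _.
suff fgk : addcomp f (jinj (bsplit k)) = addcomp g (jinj (bsplit k)).
  by rewrite -!addcompE fgk.
by apply: tens_hom_eq => x y; exact: fg.
Qed.

Lemma star_biadditive (s : bideg n) : biadditive (@star K L n s).
Proof.
have [tl tr] := tmul_biadditive (ext K (sval s).1) (ext L (sval s).2).
by split=> [y x x'|x y y'] /=; rewrite /star ?tl ?tr jin_additive.
Qed.

Definition starl (s : bideg n) (y : ext L (sval s).2) :
    {additive ext K (sval s).1 -> jcarrier K L n} :=
  HB.pack (fun x : ext K (sval s).1 => star x y)
    (GRing.isZmodMorphism.Build _ _ (fun x : ext K (sval s).1 => star x y)
      ((star_biadditive s).1 y)).

Definition starr (s : bideg n) (x : ext K (sval s).1) :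
    {additive ext L (sval s).2 -> jcarrier K L n} :=
  HB.pack (fun y : ext L (sval s).2 => star x y)
    (GRing.isZmodMorphism.Build _ _ (fun y : ext L (sval s).2 => star x y)
      ((star_biadditive s).2 x)).

End JoinSum.

(** * Currying *)

(** A pair of shifted degrees (j, i) is indexed in two ways: for Hom groups by i
    together with (j, i + j), for joins by i + j together with (j, i). *)

Lemma bideg_of_subproof i (s : hidx i) : ((sval s).1 + i == (sval s).2)%N.
Proof. by rewrite addnC; exact: svalP s. Qed.

Definition bideg_of i (s : hidx i) : bideg (sval s).2 :=
  exist _ ((sval s).1, i) (bideg_of_subproof s).

Lemma hidx_of_subproof n (s : bideg n) : ((sval s).2 + (sval s).1 == n)%N.
Proof. by rewrite addnC; exact: svalP s. Qed.

Definition hidx_of n (s : bideg n) : hidx (sval s).2 :=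
  exist _ ((sval s).1, n) (hidx_of_subproof s).

Section Curry.
Variables K L M : adc.

(** Families indexed by shifted degree; the index 0 stands for degree -1, where
    a family on a join starts from tens int int. *)
Definition jfam := forall n, {additive jcarrier K L n -> ext M n}.
Definition hfam := forall i, {additive ext L i -> hcarrier K M i}.

Definition curry_fun (F : jfam) i (y : ext L i) : hcarrier K M i :=
  fun s => addcomp (F (sval s).2) (@starl K L _ (bideg_of s) y).

Lemma curry_additive (F : jfam) i : zmod_morphism (@curry_fun F i).
Proof.
move=> y y'; apply: dprod_eq => s; apply: additive_eq => x.
rewrite dprodD dprodN homD homN !addcompE -raddfB; congr (F _ _).
exact: (star_biadditive K L (bideg_of s)).2.
Qed.

Definition curry (F : jfam) : hfam := fun i =>
  HB.pack (@curry_fun F i)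
    (GRing.isZmodMorphism.Build _ _ _ (@curry_additive F i)).

Lemma curryE (F : jfam) i y (s : hidx i) x :
  curry F i y s x = F (sval s).2 (star (s := bideg_of s) x y).
Proof. by []. Qed.

(** Stated with explicit pairs because the types of both sides depend on the
    index, so that a rewriting of the index in place is ill-typed. *)
Lemma hcarrier_irr i j m (h h' : (i + j == m)%N) (u : hcarrier K M i) x :
  (u (exist _ (j, m) h) : {additive ext K j -> ext M m}) x
  = (u (exist _ (j, m) h') : {additive ext K j -> ext M m}) x.
Proof. by rewrite (bool_irrelevance h h'). Qed.

Lemma star_curry (F : jfam) n (s : bideg n) x y :
  F n (star (s := s) x y) = curry F (sval s).2 y (hidx_of s) x.
Proof.
rewrite curryE; case: s x y => -[j i] h x y.
by rewrite /bideg_of /=; congr (F n _); exact: star_irr.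
Qed.

Lemma uncurry_biadditive (H : hfam) n (s : bideg n) :
  biadditive (fun x y => H (sval s).2 y (hidx_of s) x).
Proof.
split=> [y x x'|x y y'] /=; first exact: raddfB.
by rewrite raddfB dprodD dprodN homD homN.
Qed.

Definition uncurry (H : hfam) : jfam := fun n =>
  jcopair (fun s : bideg n => tens_lift (uncurry_biadditive H s)).

Lemma uncurry_star (H : hfam) n (s : bideg n) x y :
  uncurry H n (star (s := s) x y) = H (sval s).2 y (hidx_of s) x.
Proof. by rewrite /uncurry /star jcopair_jin tens_liftE. Qed.

Lemma uncurryK (H : hfam) i y : curry (uncurry H) i y = H i y.
Proof.
apply: dprod_eq => s; apply: additive_eq => x; rewrite curryE uncurry_star.
by case: s x => -[j m] h x; exact: hcarrier_irr.
Qed.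

Lemma curry_inj (F F' : jfam) : (forall i, curry F i =1 curry F' i) ->
  forall n, F n =1 F' n.
Proof.
by move=> FF' n; apply: jcarrier_hom_eq => s x y; rewrite !star_curry FF'.
Qed.

(** Expand d(x * y) = dx * y + (-1)^{|x|+1} x * dy: the left factor produces the
    term u_{j-1} d of the differential of the family u = curry F y, and the
    right factor produces curry F (dy).  F is not assumed to be a chain map, so
    that the identity serves both directions of the correspondence. *)
Lemma curry_bd (F : jfam) i (y : ext L i.+1) (s : hidx i) x :
  (hbd K M i (curry F i.+1 y) s x - curry F i (ebd L i y) s x)
    *~ (-1) ^+ (sval s).1
  = ebd M (sval s).2 (F (sval s).2.+1 (star (s := bideg_of (hidxR s)) x y))
    - F (sval s).2 (jbd K L _ (star (s := bideg_of (hidxR s)) x y)).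
Proof.
rewrite -[hbd _ _ _ _ _]/(hbd_fun _ _) /hbd_fun homMz homD homN.
rewrite mulrzBl sign_mulrzK.
rewrite addcompE -addrA; congr (_ + _).
rewrite -opprD; congr (- _); rewrite curryE.
case: s x => -[j m] h /=.
case: j h => [|j] h x.
  (* x has degree -1: dx = 0 and d(x * y) has a single term *)
  rewrite add0r mulr1z; congr (F m _).
  have -> : star (s := bideg_of (hidxR (exist _ (0%N, m) h))) x y
      = star (s := bidegR (bideg_of (exist _ (0%N, m) h))) x y.
    exact: star_irr.
  exact/esym/(@jbd_star_r K L m (bideg_of (exist _ (0%N, m) h)) x y).
case: m h => [|m] h; first by have := h; rewrite addnS.
have h' : (j + i == m)%N by have := h; rewrite addnS eqSS addnC.
pose s0 : bideg m := exist _ (j, i) h'.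
have -> : star (s := bideg_of (hidxR (exist _ (j.+1, m.+1) h))) x y
      = star (s := bidegL (bidegR s0)) x y by exact: star_irr.
rewrite -[jbd_fun _]/(jbd K L m.+1 _) (@jbd_star K L m s0).
rewrite raddfD raddfMz; congr (_ + _ *~ _).
  by congr (F m.+1 _); exact: star_irr.
by congr (F _ _); exact: star_irr.
Qed.

End Curry.

(** * Families of maps as chain maps *)

Section Families.
Variables (K L M : adc) (g : adc_hom K M).

(** A family on the joins satisfying these conditions is the same as a morphism
    under K from the join to M. *)
Record join_family (F : jfam K L M) : Prop := JoinFamily {
  jf_bd : forall n u, F n (jbd K L n u) = ebd M n (F n.+1 u);
  jf_unit : forall n x,
    F n (star (s := bidegl0 n) x (1 : int)) = emor g n x;
  jf_pos : forall n u, @jpos K L n u -> epos (F n u) }.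

(** A family satisfying these conditions is the same as a morphism from L to
    the slice of g.  For i = 0, [sf_bd] contains both the compatibility with
    augmentations and the condition that defines the degree 0 part of the
    slice. *)
Record slice_family (H : hfam K L M) : Prop := SliceFamily {
  sf_bd : forall i y, hbd K M i (H i.+1 y) = H i (ebd L i y);
  sf_unit : forall j, H 0 (1 : int) (hidx0 j) = emor g j;
  sf_pos : forall i y, epos y -> hmono (H i y) }.

Lemma star_bidegl0 n (x : ext K n) (m : int) :
  @star K L n (bidegl0 n) x m = star (s := bidegl0 n) x (1 : int) *~ m.
Proof.
by rewrite -[in LHS](intz m) -[LHS]/(@starr K L n (bidegl0 n) x _) raddfMz.
Qed.

Lemma jf_star0 F : join_family F -> forall n x (m : int),
  F n (star (s := bidegl0 n) x m) = emor g n x *~ m.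
Proof. by move=> FP n x m; rewrite star_bidegl0 raddfMz jf_unit. Qed.

(** In degree -1, the unit condition forces the multiplication of integers. *)
Lemma jf_tens_int F : join_family F -> forall u,
  F 0 u = tens_int (u bideg00).
Proof.
move=> FP; apply: (@jcarrier_hom_eq _ _ _ _ (F 0%N)
  (addcomp tens_int (dproj _ bideg00))) => s.
rewrite (bideg0_eq s) => x y.
have -> : star (s := bideg00) x y = star (s := bidegl0 0) x y.
  exact: star_irr.
rewrite jf_star0 // addcompE -[dproj _ _ _]/(star (s := bidegl0 0) x y bideg00).
have -> : star (s := bidegl0 0) x y = star (s := bideg00) x y.
  exact: star_irr.
by rewrite /star jin_in tens_liftE /= mulrzz.
Qed.

(** The differential conditions correspond by [curry_bd], except on the x * m
    with m in L_{-1} = Z.  There dm = 0, the second term of d(x * m) is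
    absent, and the condition on F says that g commutes with d. *)
Lemma join_family_curry (F : jfam K L M) :
  join_family F <-> slice_family (curry F).
Proof.
split=> FP; split.
- move=> i y; apply: dprod_eq => s; apply: additive_eq => x.
  have /(congr1 (fun z => z *~ (-1) ^+ (sval s).1))
    := @curry_bd _ _ _ F i y s x.
  by rewrite jf_bd // subrr mul0rz sign_mulrzK => /subr0_eq.
- move=> j; apply: additive_eq => x; rewrite curryE -(jf_unit FP).
  by congr (F j _); exact: star_irr.
- move=> i y py s x px; rewrite curryE; apply: (jf_pos FP).
  by apply: sub_gen_smallest; exists (bideg_of s), x, y.
- have unit n x : F n (star (s := bidegl0 n) x (1 : int)) = emor g n x.
    rewrite -(sf_unit FP) curryE.
    by congr (F n _); exact: star_irr.
  move=> n; apply: (@jcarrier_hom_eq _ _ _ _ (addcomp (F n) (jbd K L n))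
    (addcomp (ebd M n) (F n.+1))) => -[[j [|i]] h] x y; rewrite !addcompE.
    (* y is an integer, so x * y is y times the image of x by the inclusion *)
    have jn : j = n.+1 by have /eqP := h; rewrite addn0.
    move: h x y; rewrite {j}jn => h x y.
    have -> : star (s := exist _ (n.+1, 0%N) h) x y
       = star (s := bidegl0 n.+1) x (1 : int) *~ y.
      by rewrite -star_bidegl0; exact: star_irr.
    rewrite !raddfMz unit; congr (_ *~ _).
    rewrite -emor_ebd -unit; congr (F n _).
    rewrite -(@jbd_star_l K L n (bidegl0 n)) //; congr (jbd K L n _).
    exact: star_irr.
  have h' : (i + j == n)%N by have := h; rewrite addnS eqSS addnC.
  have := @curry_bd _ _ _ F i y (exist _ (j, n) h') x.
  rewrite (sf_bd FP) subrr mul0rz => /esym/subr0_eq /=.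
  have -> : star (s := exist _ (j, i.+1) h) x y
      = star (s := bideg_of (hidxR (exist _ (j, n) h'))) x y.
    exact: star_irr.
  by move=> ->.
- by move=> n x; rewrite -(sf_unit FP) curryE; congr (F n _); exact: star_irr.
- move=> n u; apply: (smallest_sub (X := [set v | epos (F n v)])).
    exact/submonoid_preim/epos_submonoid.
  move=> _ [s [x [y [px py ->]]]] /=; rewrite star_curry.
  exact: (sf_pos FP).
Qed.

Definition jext (f : adc_hom (join K L) M) : jfam K L M := fun n =>
  if n is m.+1 return {additive jcarrier K L n -> ext M n} then f m
  else addcomp tens_int (dproj _ bideg00).

Lemma jext_family (f : adc_hom (join K L) M) :
  adc_comp f (iota1 K L) = g -> join_family (jext f).
Proof.
move=> fg; split.
- case=> [|n] u; last exact: (hom_bd f).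
  exact: etrans (esym (jaugE u)) (esym (hom_aug f u)).
- case=> [|n] x; last by rewrite /= -fg.
  have -> : @star K L 0 (bidegl0 0) x (1 : int)
      = @star K L 0 bideg00 x (1 : int).
    exact: star_irr.
  rewrite addcompE -[dproj _ _ _]/(@star K L 0 bideg00 x (1 : int) bideg00).
  by rewrite /star jin_in tens_liftE mulr1.
- case=> [|n] u; last exact: (@hom_pos _ _ f).
  apply: (smallest_sub
    (X := [set v : jcarrier K L 0 | @epos M 0 (jext f 0 v)])).
    exact/submonoid_preim/(epos_submonoid M 0).
  move=> _ [s [x [y [px py ->]]]].
  move: x y px py; rewrite (bideg0_eq s) => x y px py.
  rewrite /mkset addcompE -[dproj _ _ _]/(star x y bideg00).
  by rewrite /star jin_in tens_liftE; exact: Num.Theory.mulr_ge0.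
Qed.

Section OfJoinFamily.
Variables (F : jfam K L M) (FP : join_family F).

Definition join_hom_of : adc_hom (join K L) M.
Proof.
refine (@AdcHom (join K L) M (fun n => F n.+1) _ _ _).
- by move=> n u; exact: (@jf_bd _ FP n.+1).
- move=> u; rewrite -[LHS](@jf_bd _ FP 0%N) (jf_tens_int FP).
  exact/esym/jaugE.
- by move=> n u; exact: (@jf_pos _ FP n.+1).
Defined.

Lemma join_hom_of_iota1 : adc_comp join_hom_of (iota1 K L) = g.
Proof. by apply: adc_hom_eq => n x; exact: (@jf_unit _ FP n.+1). Qed.

Lemma jext_join_hom_of n : jext join_hom_of n =1 F n.
Proof. by case: n => [|n] u //; rewrite (jf_tens_int FP). Qed.

End OfJoinFamily.

(** In degree 0 the slice is a subgroup of the product, and in other degrees the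
    whole product; this embedding hides the distinction. *)
Definition slice_val i : {additive slice g i -> hcarrier K M i.+1} :=
  if i is _.+1 return {additive slice g i -> hcarrier K M i.+1} then addid _
  else (val : {additive slice0 g -> hcarrier K M 1}).

Lemma slice_val_inj i : injective (@slice_val i).
Proof. by case: i => [|i] //; exact: val_inj. Qed.

Lemma slice_val_bd i u :
  slice_val i (bd (slice g) i u) = hbd K M i.+1 (slice_val i.+1 u).
Proof. by case: i u. Qed.

Lemma slice_val_pos i u : pos (slice g) i u <-> hmono (slice_val i u).
Proof. by case: i u. Qed.

(** The augmentation of the slice is the degree -1 component of its
    differential; hence the equation d(u) = e(u) (g_j)_j may be read in all
    degrees >= -1, as in [slice0_hbd]. *)
Lemma haugE (u : hcarrier K M 1) : haug K M u = hbd K M 0 u (hidx0 0) (1 : int).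
Proof.
rewrite -[RHS]/(hbd_fun u (hidx0 0) _) /hbd_fun homMz expr0 mulr1z.
rewrite homD homN subr0 addcompE; congr (aug M _).
exact: (@hcarrier_irr K M 1 0 1 _ _ u (1 : int)).
Qed.

(** The family (g_j)_j for j >= -1.  An index of [hidx 0] carries the degrees of
    source and target separately, equal only propositionally. *)
Definition hbase : hcarrier K M 0 := fun s =>
  ecast m {additive ext K (sval s).1 -> ext M m} (eqP (svalP s))
    (emor g (sval s).1).

Lemma hbaseE j : hbase (hidx0 j) = emor g j.
Proof. by rewrite /hbase eq_axiomK. Qed.

Lemma hidx0_surj (s : hidx 0) : s = hidx0 (sval s).1.
Proof.
by case: s => -[j m] h; apply: val_inj; have /eqP := h; rewrite add0n /= => <-.
Qed.

Lemma hbase_mono : hmono hbase.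
Proof.
by move=> s; rewrite (hidx0_surj s) hbaseE => x; exact: emor_epos.
Qed.

Definition hbase_mul_fun (m : int) : hcarrier K M 0 := hbase *~ m.

Lemma hbase_mul_additive : zmod_morphism hbase_mul_fun.
Proof. by move=> m n; exact: mulrzBr. Qed.

Definition hbase_mul : {additive int -> hcarrier K M 0} :=
  HB.pack hbase_mul_fun (GRing.isZmodMorphism.Build _ _ _ hbase_mul_additive).

Definition hext (h : adc_hom L (slice g)) : hfam K L M := fun i =>
  if i is i'.+1 return {additive ext L i -> hcarrier K M i}
  then addcomp (slice_val i') (h i') else hbase_mul.

Lemma slice0_hbd (u : slice0 g) : hbd K M 0 (val u) = hbase *~ haug K M (val u).
Proof.
apply: dprod_eq => s; rewrite (hidx0_surj s) dprodMz hbaseE.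
case: (sval s).1 => [|j]; last by have /asboolP -> := slice0P u.
apply: additive_eq; apply: int_additive_eq.
by rewrite -haugE homMz /= intz.
Qed.

Lemma hext_family h : slice_family (hext h).
Proof.
split.
- case=> [|i] y; last first.
    rewrite [RHS]addcompE -[ebd _ _ _]/(bd L i y) (hom_bd h).
    exact/esym/slice_val_bd.
  by rewrite [LHS]slice0_hbd -(hom_aug h).
- by move=> j; rewrite /= /hbase_mul_fun mulr1z hbaseE.
- case=> [|i] y py; last exact/slice_val_pos/hom_pos.
  rewrite /= /hbase_mul_fun; case: y py => // n _.
  elim: n => [|n IHn]; first exact: (hmono_submonoid K M 0).1.
  by rewrite -pmulrn mulrSr; apply: (hmono_submonoid K M 0).2 => //;
    exact: hbase_mono.
Qed.

Section OfSliceFamily.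
Variables (H : hfam K L M) (HP : slice_family H).

Lemma sf_hbase m : H 0 m = hbase *~ m.
Proof.
rewrite -[in LHS](intz m) raddfMz; congr (_ *~ _); apply: dprod_eq => s.
by rewrite (hidx0_surj s) hbaseE (sf_unit HP).
Qed.

Lemma sf_haug y : haug K M (H 1 y) = aug L y.
Proof.
by rewrite haugE (sf_bd HP) sf_hbase dprodMz hbaseE homMz /= intz.
Qed.

Lemma sf_slice0 y : H 1 y \in slice0_pred g.
Proof.
apply/asboolP => j; rewrite sf_haug (sf_bd HP) sf_hbase dprodMz.
by rewrite hbaseE.
Qed.

Definition slice_hom0_fun (y : L 0) : slice0 g := Slice0 (sf_slice0 y).

Lemma slice_hom0_additive : zmod_morphism slice_hom0_fun.
Proof.
by move=> u v; apply: val_inj; rewrite [RHS]raddfB; exact: (raddfB (H 1)).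
Qed.

Definition slice_hom_map i : {additive L i -> slice g i} :=
  if i is i'.+1 return {additive L i -> slice g i} then H i'.+2
  else HB.pack slice_hom0_fun
    (GRing.isZmodMorphism.Build _ _ _ slice_hom0_additive).

Lemma slice_hom_mapE i y : slice_val i (slice_hom_map i y) = H i.+1 y.
Proof. by case: i y. Qed.

Definition slice_hom_of : adc_hom L (slice g).
Proof.
refine (@AdcHom L (slice g) slice_hom_map _ _ _).
- move=> i y; apply: slice_val_inj; rewrite slice_val_bd !slice_hom_mapE.
  exact/esym/(sf_bd HP).
- exact: sf_haug.
- move=> i y py; apply/slice_val_pos; rewrite slice_hom_mapE.
  exact: (sf_pos HP).
Defined.

Lemma hext_slice_hom_of i : hext slice_hom_of i =1 H i.
Proof.
case: i => [|i] y; first by rewrite sf_hbase.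
exact: slice_hom_mapE.
Qed.

End OfSliceFamily.

Lemma hext_inj (h h' : adc_hom L (slice g)) :
  (forall i, hext h i =1 hext h' i) -> h = h'.
Proof.
move=> hh'; apply: adc_hom_eq => i y; apply: slice_val_inj.
exact: (hh' i.+1).
Qed.

End Families.

(** * The adjunction *)

Section Adjunction.
Variable K : adc.
Local Notation J := (join_functor K).
Local Notation S := (slice_functor K).

Definition adj (L : Cda) (X : @under Cda K) (f : hom (J L) X) : hom L (S X) :=
  slice_hom_of ((join_family_curry _ _).1 (jext_family (under_comm f))).

Lemma hext_adj (L : Cda) (X : @under Cda K) (f : hom (J L) X) i :
  hext (adj f) i =1 curry (jext (under_fun f)) i.
Proof. exact: hext_slice_hom_of. Qed.

Lemma uncurry_family (L : Cda) (X : @under Cda K) (h : hom L (S X)) :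
  join_family (under_map X) (uncurry (hext h)).
Proof.
apply/join_family_curry.
have <- // : hext h = curry (uncurry (hext h)); last exact: hext_family.
apply: functional_extensionality_dep => i.
by apply: additive_eq => y; rewrite uncurryK.
Qed.

Definition adj_inv (L : Cda) (X : @under Cda K) (h : hom L (S X)) :
    hom (J L) X :=
  @UnderHom Cda K (J L) X (join_hom_of (uncurry_family h))
    (join_hom_of_iota1 (uncurry_family h)).

Lemma adj_bij (L : Cda) (X : @under Cda K) : bijective (@adj L X).
Proof.
exists (@adj_inv L X) => [f|h].
  apply: under_hom_eq; apply: adc_hom_eq => n u.
  rewrite -[RHS]/(jext (under_fun f) n.+1 u).
  apply: (@curry_inj K L (under_cod X) (uncurry (hext (adj f)))
    (jext (under_fun f)) _ n.+1 u) => i y.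
  by rewrite uncurryK hext_adj.
apply: hext_inj => i y; rewrite hext_adj -[RHS]uncurryK.
have -> // : jext (under_fun (adj_inv h)) = uncurry (hext h).
apply: functional_extensionality_dep => n; apply: additive_eq.
exact: jext_join_hom_of.
Qed.

Lemma adj_natural (L L' : Cda) (X X' : @under Cda K) (a : hom L' L)
    (b : hom X X') (f : hom (J L) X) :
  adj (comp b (comp f (fmap J a))) = comp (fmap S b) (comp (adj f) a).
Proof.
apply: adc_hom_eq => i y; apply: slice_val_inj.
(* the target degree is i.+1 + j, hence a successor *)
apply: dprod_eq => -[[j [|m]] h] //; apply: additive_eq => x.
have -> : slice_val _ i (adj (comp b (comp f (fmap J a))) i y)
  = curry (jext (under_fun (comp b (comp f (fmap J a))))) i.+1 y.
  exact: (@hext_adj _ _ _ i.+1).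
have -> : slice_val _ i ((comp (fmap S b) (comp (adj f) a) : adc_hom _ _) i y)
  = hmap K (under_fun b) i.+1 (slice_val _ i (adj f i ((a : adc_hom _ _) i y))).
  by case: (i) y.
have -> : slice_val _ i (adj f i ((a : adc_hom _ _) i y))
  = curry (jext (under_fun f)) i.+1 ((a : adc_hom _ _) i y).
  exact: (@hext_adj _ _ f i.+1).
have e := @jmap_star K L' L a m.+1
  (bideg_of (exist _ (j, m.+1) h : hidx i.+1)) x y.
exact: (congr1 (fun z => (under_fun b : adc_hom _ _) m
  ((under_fun f : adc_hom _ _) m z)) e).
Qed.

End Adjunction.

Theorem proposition10p1p4 (K : adc) :
  adjoint (join_functor K) (slice_functor K).
Proof.
exists (@adj K); split; [exact: adj_bij|exact: adj_natural].
Qed.
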